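(* For every effective generalized pushdown automaton $\mathcal{P}$ and every $\mathcal{P}$-automaton $\mathcal{A}$, it is possible to (effectively) construct a $\mathcal{P}$-automaton $\mathcal{A}'$ such that $L_{\mathcal{P}}(\mathcal{A}') = \mathit{Pre}^*_{\mathcal{T}(\mathcal{P})}(L_{\mathcal{P}}(\mathcal{A}))$.
   Context: For a finite alphabet $X$, $X_\epsilon = X\cup\{\epsilon\}$. A finite state automaton (FSA) is $\mathcal{A}=(Q_{\mathcal{A}},\Gamma,\Delta_{\mathcal{A}},I_{\mathcal{A}},F_{\mathcal{A}})$ with finite state set, transitions $\Delta_{\mathcal{A}}\subseteq Q_{\mathcal{A}}\times\Gamma_\epsilon\times Q_{\mathcal{A}}$, initial states $I_{\mathcal{A}}$ and final states $F_{\mathcal{A}}$; for $I',F'\subseteq Q_{\mathcal{A}}$, $\mathcal{A}(I',F')$ denotes the same automaton with initial states $I'$ and final states $F'$, and $L(\cdot)$ is the accepted language. A generalized pushdown automaton (GPA) is a tuple $\mathcal{P}=(P,\Sigma,\Gamma,\delta,p_0,\gamma_0,F)$ where $P$ is a finite nonempty set of states, $\Sigma$ an input alphabet, $\Gamma$ a stack alphabet, $\delta: P\times\Gamma\times\Sigma_\epsilon\times P\to 2^{\Gamma^*}$ assigns to each tuple a (possibly infinite) language over $\Gamma$, $p_0\in P$, $\gamma_0\in\Gamma$, $F\subseteq P$. Configurations are pairs $(p,w)\in P\times\Gamma^*$. The transition system $\mathcal{T}(\mathcal{P})$ has a step $(p,\gamma w)\xrightarrow{a}(p',uw)$ whenever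 $u\in\delta(p,\gamma,a,p')$ and $w\in\Gamma^*$. $\mathcal{P}$ is effective if for every FSA $\mathcal{B}$ over $\Gamma$ it is decidable whether $L(\mathcal{B})\cap\delta(p,\gamma,a,p')\neq\emptyset$, for all $p,p'\in P$, $\gamma\in\Gamma$, $a\in\Sigma_\epsilon$. A $\mathcal{P}$-automaton is an FSA $\mathcal{A}$ over alphabet $\Gamma$ whose set of initial states is $P$; it accepts the configuration $(p,w)$ iff $w\in L(\mathcal{A}(\{p\},F_{\mathcal{A}}))$; $L_{\mathcal{P}}(\mathcal{A})$ is the set of configurations it accepts. For a set $C$ of configurations, $\mathit{Pre}^*_{\mathcal{T}(\mathcal{P})}(C)$ is the set of configurations from which some configuration of $C$ is reachable by a finite (possibly empty) sequence of steps of $\mathcal{T}(\mathcal{P})$. *)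

(* Defs.v *)
From Stdlib Require Import Relations.
From mathcomp Require Import all_boot.

Set Implicit Arguments.
Unset Strict Implicit.
Unset Printing Implicit Defensive.

(* Model of computation: the weak call-by-value lambda-calculus L of Forster  *)
(* and Smolka, in de Bruijn style.  It is Turing-complete, so "decidable" and *)
(* "effectively constructible" are rendered by the existence of an L-program  *)
(* rather than of a Rocq function; a Rocq function would carry no computa-    *)
(* tional content in the presence of classical choice.                        *)

Inductive term : Type :=
| Var of nat
| App of term & term
| Lam of term.

(* No shifting of u is needed: only closed terms are ever substituted. *)
Fixpoint subst (s : term) (k : nat) (u : term) : term :=
  match s with
  | Var n => if n == k then u else Var n
  | App s1 s2 => App (subst s1 k u) (subst s2 k u)
  | Lam s1 => Lam (subst s1 k.+1 u)
  end.

Inductive red : term -> term -> Prop :=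
| red_beta s t : red (App (Lam s) (Lam t)) (subst s 0 (Lam t))
| red_appl s s' t : red s s' -> red (App s t) (App s' t)
| red_appr s t t' : red t t' -> red (App s t) (App s t').

Definition closed_term (s : term) : Prop := forall k u, subst s k u = s.

Definition abstraction (s : term) : Prop := exists t, s = Lam t.

Definition program (s : term) : Prop := closed_term s /\ abstraction s.

Definition evaluates (s t : term) : Prop :=
  clos_refl_trans term red s t /\ abstraction t.

Definition apps (s : term) (args : seq term) : term := foldl App s args.

(* Scott encodings: a value is its own case-analysis function. *)

Definition enc_bool (b : bool) : term :=
  Lam (Lam (Var (if b then 1 else 0))).

Fixpoint enc_nat (n : nat) : term :=
  if n is m.+1 then Lam (Lam (App (Var 0) (enc_nat m))) else Lam (Lam (Var 1)).

Definition enc_pair (s t : term) : term := Lam (App (App (Var 0) s) t).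

Definition enc_option T (e : T -> term) (o : option T) : term :=
  if o is Some x then Lam (Lam (App (Var 1) (e x))) else Lam (Lam (Var 0)).

Fixpoint enc_seq T (e : T -> term) (l : seq T) : term :=
  if l is x :: l' then Lam (Lam (App (App (Var 0) (e x)) (enc_seq e l')))
  else Lam (Lam (Var 1)).

Definition enc_fin (T : finType) (x : T) : term := enc_nat (enum_rank x).

Definition enc_set (T : finType) (e : T -> term) (A : {set T}) : term :=
  enc_seq e (enum A).

(* In this file None : option X plays the role of the empty word in           *)
(* X_epsilon = X + {epsilon}.                                                 *)

Record fsa (X : finType) := Fsa {
  fsa_state : finType;
  fsa_trans : {set fsa_state * option X * fsa_state};
  fsa_init : {set fsa_state};
  fsa_final : {set fsa_state}
}.

Definition fsa_with (X : finType) (A : fsa X) (I F : {set fsa_state A}) : fsa X :=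
  Fsa (fsa_trans A) I F.

Inductive fsa_run (X : finType) (A : fsa X) :
  fsa_state A -> seq X -> fsa_state A -> Prop :=
| fsa_run_nil q : fsa_run q [::] q
| fsa_run_eps q q' q'' w :
    (q, None, q') \in fsa_trans A -> fsa_run q' w q'' -> fsa_run q w q''
| fsa_run_sym q x q' q'' w :
    (q, Some x, q') \in fsa_trans A -> fsa_run q' w q'' ->
    fsa_run q (x :: w) q''.

Definition fsa_lang (X : finType) (A : fsa X) (w : seq X) : Prop :=
  exists q q', [/\ q \in fsa_init A, q' \in fsa_final A & fsa_run q w q'].

Record gpa := Gpa {
  gpa_state : finType;
  gpa_input : finType;
  gpa_stack : finType;
  gpa_delta : gpa_state -> gpa_stack -> option gpa_input -> gpa_state ->
              seq gpa_stack -> Prop;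
  gpa_init : gpa_state;
  gpa_bottom : gpa_stack;
  gpa_final : {set gpa_state}
}.

Definition config (P : gpa) : Type := (gpa_state P * seq (gpa_stack P))%type.

Inductive gpa_step (P : gpa) :
  config P -> option (gpa_input P) -> config P -> Prop :=
| GpaStep p g a p' u w :
    gpa_delta p g a p' u -> gpa_step (p, g :: w) a (p', u ++ w).

Definition pre_star (P : gpa) (C : config P -> Prop) (c : config P) : Prop :=
  exists2 c', C c' &
    clos_refl_trans (config P) (fun c1 c2 => exists a, gpa_step c1 a c2) c c'.

(* The inclusion of the states of P among those of the automaton is an        *)
(* injection.                                                                 *)
Record paut (P : gpa) := Paut {
  paut_fsa :> fsa (gpa_stack P);
  paut_inj : gpa_state P -> fsa_state paut_fsa;
  paut_inj_inj : injective paut_inj;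
  paut_initE : fsa_init paut_fsa = [set paut_inj p | p : gpa_state P]
}.

Definition paut_lang (P : gpa) (A : paut P) (c : config P) : Prop :=
  fsa_lang (fsa_with [set paut_inj A c.1] (fsa_final A)) c.2.

Definition enc_fsa (X : finType) (A : fsa X) : term :=
  let enc_trans t :=
    enc_pair (enc_fin t.1.1) (enc_pair (enc_option (@enc_fin X) t.1.2)
                                       (enc_fin t.2)) in
  enc_pair (enc_nat #|fsa_state A|)
    (enc_pair (enc_set enc_trans (fsa_trans A))
      (enc_pair (enc_set (@enc_fin _) (fsa_init A))
                (enc_set (@enc_fin _) (fsa_final A)))).

Definition enc_paut (P : gpa) (A : paut P) : term :=
  enc_pair (enc_fsa A)
    (enc_seq (@enc_fin _) [seq paut_inj A p | p <- enum (gpa_state P)]).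

(* All the components of P but delta, whose values may be infinite languages; *)
(* programs access delta only through a decision procedure as below.          *)
Definition enc_gpa (P : gpa) : term :=
  enc_pair (enc_nat #|gpa_state P|)
    (enc_pair (enc_nat #|gpa_input P|)
      (enc_pair (enc_nat #|gpa_stack P|)
        (enc_pair (enc_fin (gpa_init P))
          (enc_pair (enc_fin (gpa_bottom P))
                    (enc_set (@enc_fin _) (gpa_final P)))))).

(* P is effective iff effective_by P d holds for some d. *)
Definition effective_by (P : gpa) (d : term) : Prop :=
  program d /\
  forall (B : fsa (gpa_stack P)) (p : gpa_state P) (g : gpa_stack P)
         (a : option (gpa_input P)) (p' : gpa_state P),
  exists2 b : bool,
    evaluates (apps d [:: enc_fsa B; enc_fin p; enc_fin g;
                          enc_option (@enc_fin _) a; enc_fin p'])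
              (enc_bool b)
    & b <-> exists2 u, fsa_lang B u & gpa_delta p g a p' u.

(* Main.v *)
Require Import Defs.
From Stdlib Require Import Relations.
From mathcomp Require Import all_boot.

(* A' has state set P + Q: fresh copies of the states of P, with epsilon      *)
(* moves to the states of A they stand for, so that no copied transition      *)
(* enters an initial state. Saturate by adding (p, g, q) whenever some word   *)
(* u of delta p g a p' is read by the current automaton from p' to q. Each    *)
(* new transition from p simulates steps of P followed by a run of A, because *)
(* after the first transition the run stays in A, or has popped everything    *)
(* read so far and sits in an initial state again; conversely, at the         *)
(* fixpoint every step of P is matched. The saturation operator is monotone,  *)
(* so iterating it as often as there are transitions reaches its least        *)
(* fixpoint. As finite sets are encoded in enumeration order, the L-program   *)
(* computes each iterate by filtering the list of all transitions.            *)

(** Correctness is a statement about runs of the saturated automaton [sat]. For completeness, [sat]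
    is a fixpoint ([in_sat]): if u lies in δ(p,g,a,p') and [sat] reads u from [inl p'] to r, then
    (p,g,r) is a transition. Splitting a run on u ++ w after u thus turns it into a run on g :: w,
    so acceptance moves backward along steps ([run_saturate_complete]), starting from copied runs of
    [A] ([run_sat_lift]). For soundness, [run_saturate_sound] shows that a run from [inl p] is a
    sequence of steps followed by a genuine run of [A], by induction on the iterate and then on the
    run. It rests on [run_saturate1_inr]: no run escapes from the copy of [A]. Both directions meet
    in [sat_pautP]. For effectiveness, the only infinite datum is δ, and saturation needs just the
    queries whether a word of δ(p,g,a,p') is read from [inl p'] to q, which [d] answers. Each
    L-program has an [_ev] lemma saying that it takes encodings to encodings; [SATURATE_ev] and
    [MAIN_ev] culminate in a single program, uniform in the pushdown automaton, [d] and [A]. *)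

Set Implicit Arguments.
Unset Strict Implicit.
Unset Printing Implicit Defensive.

(** * Programming in L *)

(* Terms with named binders: a scoped term is a function of the number of     *)
(* binders above it, and lam turns levels into de Bruijn indices.             *)
Definition scoped := nat -> term.
Definition cst (t : term) : scoped := fun _ => t.
Definition lam (f : scoped -> scoped) : scoped :=
  fun n => Lam (f (fun m => Var (m - n.+1)) n.+1).
Definition app (s t : scoped) : scoped := fun n => App (s n) (t n).
Definition close (s : scoped) : term := s 0.
Coercion cst : term >-> scoped.

Declare Scope prog_scope.
Delimit Scope prog_scope with prog.
Bind Scope prog_scope with scoped.
Notation "'fn' x .. y => t" := (lam (fun x => .. (lam (fun y => t%prog)) ..))
  (at level 200, x binder, y binder, t at level 200) : prog_scope.
Notation "s @ t" := (app s t) (at level 40, left associativity) : prog_scope.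
Arguments close s%_prog.
Arguments app (s t)%_prog.
Arguments lam f%_prog.

(** * Reduction in L and its automation *)

Notation "s >* t" := (clos_refl_trans term red s t) (at level 70).

Lemma star_app s s' t t' r :
  s >* s' -> t >* t' -> App s' t' >* r -> App s t >* r.
Proof.
move=> hs ht; apply: rt_trans; apply: (@rt_trans _ _ _ (App s' t)).
  elim: hs => [x y xy|x|x y z _ xy _ yz]; first exact/rt_step/red_appl.
    exact: rt_refl.
  exact: rt_trans xy yz.
elim: ht => [x y xy|x|x y z _ xy _ yz]; first exact/rt_step/red_appr.
  exact: rt_refl.
exact: rt_trans xy yz.
Qed.

Lemma star_beta b v r : program v -> subst b 0 v >* r -> App (Lam b) v >* r.
Proof. by case=> _ [t ->]; apply: rt_trans; apply/rt_step/red_beta. Qed.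

Lemma program_subst t k u : program t -> subst t k u = t.
Proof. by case=> h _; apply: h. Qed.

Lemma program_lam b : (forall k u, subst b k.+1 u = b) -> program (Lam b).
Proof. by move=> h; split; [move=> k u; rewrite /= h | exists b]. Qed.

Create HintDb prog.
Create HintDb ev.

Ltac decide_ifs :=
  repeat match goal with
  | |- context [if ?b then _ else _] =>
      let v := eval compute in b in
      match v with true => idtac | false => idtac end; change b with v; cbn iota
  end.

Ltac prog := solve [eauto 12 with prog nocore | prog_lam]
with prog_lam := apply: program_lam => ? ?; subst_closed; reflexivity
(* Abstracting with pattern is syntactic, whereas rewrite would confuse       *)
(* convertible encodings, such as those of false and None.                    *)
with subst_closed :=
  cbn [subst]; decide_ifs;
  repeat match goal with
  | |- context [subst ?t ?k ?u] =>
      let H := fresh in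
      assert (H : program t) by prog;
      pattern (subst t k u);
      refine (@eq_ind_r _ t _ _ _ (program_subst k u H));
      cbv beta; clear H
  end.

(* Call-by-value evaluation of the left-hand side, by beta when the head is   *)
(* an explicit Lam and by the lemmas of the base ev otherwise; the named      *)
(* programs are never unfolded, which keeps recursive calls folded.           *)
Ltac ev :=
  lazymatch goal with
  | |- App _ _ >* _ => eapply star_app; [ev | ev | ev_head]
  | |- _ => apply: rt_refl
  end
with ev_head :=
  lazymatch goal with
  | |- App (Lam _) _ >* _ => eapply star_beta; [prog | subst_closed; ev]
  | |- _ => first
      [ eapply rt_trans; [solve [eauto 12 with ev prog nocore] | ev]
      | eapply rt_trans; [ev_higher_order | ev]
      | apply: rt_refl ]
  end
with ev_higher_order := fail.

Ltac ev_partly := eapply rt_trans; [ev |].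

#[local] Hint Extern 3 (program (Lam _)) => prog_lam : prog.

Lemma enc_bool_program b : program (enc_bool b).
Proof. by case: b; apply: program_lam. Qed.

Lemma enc_nat_program n : program (enc_nat n).
Proof.
elim: n => [|n IHn] /=; first exact: program_lam.
by apply: program_lam => k u; subst_closed.
Qed.

Lemma enc_pair_program s t : program s -> program t -> program (enc_pair s t).
Proof. by move=> hs ht; apply: program_lam => k u; subst_closed. Qed.

Lemma enc_option_program T (e : T -> term) o :
  (forall x, program (e x)) -> program (enc_option e o).
Proof. by move=> he; case: o => [x|] /=; prog. Qed.

Lemma enc_seq_program T (e : T -> term) l :
  (forall x, program (e x)) -> program (enc_seq e l).
Proof. by move=> he; elim: l => [|x l IHl] /=; prog. Qed.

Lemma enc_fin_program (T : finType) (x : T) : program (enc_fin x).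
Proof. exact: enc_nat_program. Qed.

#[local] Hint Resolve enc_bool_program enc_nat_program enc_pair_program
  enc_option_program enc_seq_program enc_fin_program : prog.

Lemma enc_pair_ev s t f : program s -> program t -> program f ->
  App (enc_pair s t) f >* App (App f s) t.
Proof. by move=> *; rewrite /enc_pair; ev. Qed.

Lemma enc_bool_ev b s t : program s -> program t ->
  App (App (enc_bool b) s) t >* if b then s else t.
Proof. by move=> *; rewrite /enc_bool; case: b; ev. Qed.

(** * Recursion and constructors under call by value *)

Definition omega_fix : term := Eval cbv in
  close (fn r f => f @ (fn x => r @ r @ f @ x)).

(** A fixed-point combinator in the style of Turing. The eta-expansion makes [rho u] a value, so
    that recursion unfolds only when an argument arrives. *)
Definition rho (u : term) : term := Eval cbv in
  close (fn x => omega_fix @ omega_fix @ u @ x).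

Lemma rho_program u : program u -> program (rho u).
Proof. by move=> hu; prog. Qed.

Lemma rho_ev u v : program u -> program v ->
  App (rho u) v >* App (App u (rho u)) v.
Proof. by move=> hu hv; rewrite /rho; ev. Qed.

#[local] Hint Resolve rho_program : prog.
#[local] Hint Resolve enc_pair_ev : ev.

Definition TRUE := enc_bool true.
Definition FALSE := enc_bool false.
Definition NIL : term := Lam (Lam (Var 1)).
Definition NONE : term := Lam (Lam (Var 0)).
Definition ZERO : term := Lam (Lam (Var 1)).
Definition SUCC : term := Eval cbv in close (fn n a b => b @ n).
Definition SOME : term := Eval cbv in close (fn x a b => a @ x).
Definition PAIR : term := Eval cbv in close (fn x y f => f @ x @ y).
Definition CONS : term := Eval cbv in close (fn x l a b => b @ x @ l).

Lemma TRUE_program : program TRUE. Proof. exact: enc_bool_program. Qed.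
Lemma FALSE_program : program FALSE. Proof. exact: enc_bool_program. Qed.
#[local] Hint Resolve TRUE_program FALSE_program : prog.
Lemma SUCC_program : program SUCC. Proof. prog. Qed.
Lemma SOME_program : program SOME. Proof. prog. Qed.
Lemma PAIR_program : program PAIR. Proof. prog. Qed.
Lemma CONS_program : program CONS. Proof. prog. Qed.
#[local] Hint Resolve SUCC_program SOME_program PAIR_program CONS_program
  : prog.

Lemma SUCC_ev n : App SUCC (enc_nat n) >* enc_nat n.+1.
Proof. by rewrite /SUCC; ev. Qed.

Lemma SOME_ev T (e : T -> term) x : program (e x) ->
  App SOME (e x) >* enc_option e (Some x).
Proof. by move=> *; rewrite /SOME; ev. Qed.

Lemma PAIR_ev s t : program s -> program t ->
  App (App PAIR s) t >* enc_pair s t.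
Proof. by move=> *; rewrite /PAIR; ev. Qed.

Lemma CONS_ev T (e : T -> term) x l : (forall y, program (e y)) ->
  App (App CONS (e x)) (enc_seq e l) >* enc_seq e (x :: l).
Proof. by move=> *; rewrite /CONS; ev. Qed.
#[local] Hint Resolve SUCC_ev SOME_ev PAIR_ev CONS_ev : ev.

Lemma and_ev a b :
  App (App (enc_bool a) (enc_bool b)) FALSE >* enc_bool (a && b).
Proof.
by case: a; apply: enc_bool_ev (enc_bool_program b) (enc_bool_program false).
Qed.

Lemma or_ev a b : App (App (enc_bool a) TRUE) (enc_bool b) >* enc_bool (a || b).
Proof.
by case: a; apply: enc_bool_ev (enc_bool_program true) (enc_bool_program b).
Qed.
#[local] Hint Resolve and_ev or_ev : ev.

(** * Folds, arithmetic and list functions *)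

Definition FOLDR_body : term := Eval cbv in
  close (fn self f z l => l @ z @ (fn x l' => f @ x @ (self @ f @ z @ l'))).
Definition FOLDR := rho FOLDR_body.

Lemma FOLDR_program : program FOLDR. Proof. prog. Qed.
#[local] Hint Resolve FOLDR_program : prog.

Lemma FOLDR_ev A B (eA : A -> term) (eB : B -> term) f b F l :
  (forall x, program (eA x)) -> (forall y, program (eB y)) -> program F ->
  (forall x y, App (App F (eA x)) (eB y) >* eB (f x y)) ->
  App (App (App FOLDR F) (eB b)) (enc_seq eA l) >* eB (foldr f b l).
Proof.
move=> hA hB hF Ff.
(* One unfolding for an arbitrary list value: the recursive call stays frozen under the binders of
   the cons branch, and the Scott-encoded list then selects the branch. *)
have unfold L : program L -> App (App (App FOLDR F) (eB b)) L >*
    App (App L (eB b)) (Lam (Lam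
      (App (App F (Var 1)) (App (App (App FOLDR F) (eB b)) (Var 0))))).
  move=> hL; apply: star_app; [|exact: rt_refl|].
    apply: star_app; [|exact: rt_refl|].
      by apply: rho_ev; prog.
    rewrite -/FOLDR /FOLDR_body; ev.
  ev.
elim: l => [|x l IHl]; apply: rt_trans (unfold _ _) _; try prog;
  (* Without [unfold] in the context, the automation treats the recursive call by the induction
     hypothesis instead of unfolding again. *)
  by clear unfold => /=; ev.
Qed.

Definition ITER_body : term := Eval cbv in
  close (fn self f z n => n @ z @ (fn m => f @ (self @ f @ z @ m))).
Definition ITER := rho ITER_body.

Lemma ITER_program : program ITER. Proof. prog. Qed.
#[local] Hint Resolve ITER_program : prog.

Lemma ITER_ev B (eB : B -> term) f b F n :
  (forall y, program (eB y)) -> program F ->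
  (forall y, App F (eB y) >* eB (f y)) ->
  App (App (App ITER F) (eB b)) (enc_nat n) >* eB (iter n f b).
Proof.
move=> hB hF Ff.
have unfold L : program L -> App (App (App ITER F) (eB b)) L >*
    App (App L (eB b)) (Lam
      (App F (App (App (App ITER F) (eB b)) (Var 0)))).
  move=> hL; apply: star_app; [|exact: rt_refl|].
    apply: star_app; [|exact: rt_refl|].
      by apply: rho_ev; prog.
    rewrite -/ITER /ITER_body; ev.
  ev.
elim: n => [|n IHn]; apply: rt_trans (unfold _ _) _; try prog;
  by clear unfold => /=; ev.
Qed.

Definition ADD : term := Eval cbv -[ITER SUCC] in
  close (fn m n => ITER @ SUCC @ n @ m).
Lemma ADD_program : program ADD. Proof. prog. Qed.

Lemma ADD_ev m n : App (App ADD (enc_nat m)) (enc_nat n) >* enc_nat (m + n).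
Proof.
have H := @ITER_ev _ enc_nat succn n SUCC m enc_nat_program SUCC_program
  SUCC_ev.
by rewrite iter_succn addnC in H; rewrite /ADD; ev.
Qed.

(* The closure that EQN obtains from its first argument m, a curried test     *)
(* against m.                                                                 *)
Definition eqn_fun (m : nat) : term :=
  iter m (fun f => Lam (App (App (Var 0) FALSE) f))
    (Lam (App (App (Var 0) TRUE) (Lam FALSE))).
Definition EQN : term := Eval cbv -[ITER TRUE FALSE] in
  close (fn m n => ITER @ (fn f n => n @ FALSE @ f) @
                   (fn n => n @ TRUE @ (fn _ => FALSE)) @ m @ n).
Lemma EQN_program : program EQN. Proof. prog. Qed.

Lemma EQN_ev m n :
  App (App EQN (enc_nat m)) (enc_nat n) >* enc_bool (m == n).
Proof.
have hE k : program (eqn_fun k).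
  by elim: k => [|k IHk] /=; rewrite /eqn_fun /=; prog.
(* [ITER_ev] with a natural k encoded by its test closure [eqn_fun k]: on these the loop body acts
   as the successor. *)
have H : App (App (App ITER (Lam (Lam (App (App (Var 0) FALSE) (Var 1)))))
    (eqn_fun 0)) (enc_nat m) >* eqn_fun (iter m succn 0).
  by apply: ITER_ev => //; [prog | move=> k; ev].
have {}H : App (App EQN (enc_nat m)) (enc_nat n) >* App (eqn_fun m) (enc_nat n).
  move: H; rewrite iter_succn add0n => H.
  by rewrite /EQN; ev.
apply: rt_trans H _; elim: m n => [|m IHm] [|n] /=.
- by rewrite /eqn_fun /=; ev.
- by rewrite /eqn_fun /=; ev.
- by rewrite /eqn_fun /=; ev.
have {}IHm := IHm n.
by ev.
Qed.

Definition MAP : term := Eval cbv -[FOLDR CONS NIL] in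
  close (fn f l => FOLDR @ (fn x a => CONS @ (f @ x) @ a) @ NIL @ l).
Definition CAT : term := Eval cbv -[FOLDR CONS] in
  close (fn l1 l2 => FOLDR @ CONS @ l2 @ l1).
Definition FILTER : term := Eval cbv -[FOLDR CONS NIL] in
  close (fn f l => FOLDR @ (fn x a => f @ x @ (CONS @ x @ a) @ a) @ NIL @ l).
Definition HAS : term := Eval cbv -[FOLDR TRUE FALSE] in
  close (fn f l => FOLDR @ (fn x a => f @ x @ TRUE @ a) @ FALSE @ l).
Lemma MAP_program : program MAP. Proof. prog. Qed.
Lemma CAT_program : program CAT. Proof. prog. Qed.
Lemma FILTER_program : program FILTER. Proof. prog. Qed.
Lemma HAS_program : program HAS. Proof. prog. Qed.
#[local] Hint Resolve ADD_program EQN_program MAP_program CAT_program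
  FILTER_program HAS_program : prog.

Section Lists.
Variables (A B : Type) (eA : A -> term) (eB : B -> term).
Hypotheses (hA : forall x, program (eA x)) (hB : forall y, program (eB y)).

Lemma MAP_ev (f : A -> B) F l :
  program F -> (forall x, App F (eA x) >* eB (f x)) ->
  App (App MAP F) (enc_seq eA l) >* enc_seq eB (map f l).
Proof.
move=> hF Ff.
have H := @FOLDR_ev _ _ eA (enc_seq eB) (fun x a => f x :: a) [::]
  (Lam (Lam (App (App CONS (App F (Var 1))) (Var 0)))) l hA.
by rewrite /MAP; ev_partly; apply: H => [|| x y]; try prog; ev.
Qed.

Lemma CAT_ev (l1 l2 : seq A) :
  App (App CAT (enc_seq eA l1)) (enc_seq eA l2) >* enc_seq eA (l1 ++ l2).
Proof.
have H := @FOLDR_ev _ _ eA (enc_seq eA) cons l2 CONS l1 hA.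
have -> : l1 ++ l2 = foldr cons l2 l1 by elim: l1 {H} => //= ? ? ->.
by rewrite /CAT; ev.
Qed.

Lemma FILTER_ev (p : pred A) F l :
  program F -> (forall x, App F (eA x) >* enc_bool (p x)) ->
  App (App FILTER F) (enc_seq eA l) >* enc_seq eA (filter p l).
Proof.
move=> hF Ff.
have H := @FOLDR_ev _ _ eA (enc_seq eA) (fun x a => if p x then x :: a else a)
 [::] (Lam (Lam (App (App (App F (Var 1)) (App (App CONS (Var 1)) (Var 0)))
       (Var 0)))) l hA.
rewrite /FILTER; ev_partly; apply: H => [|| x y]; try prog.
(* Call by value computes both candidate lists before the boolean selects one. *)
have := enc_bool_ev (p x) (enc_seq_program (x :: y) hA) (enc_seq_program y hA).
by rewrite -fun_if => ?; ev.
Qed.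

Lemma HAS_ev (p : pred A) F l :
  program F -> (forall x, App F (eA x) >* enc_bool (p x)) ->
  App (App HAS F) (enc_seq eA l) >* enc_bool (has p l).
Proof.
move=> hF Ff.
have H := @FOLDR_ev _ _ eA enc_bool (fun x a => p x || a) false
 (Lam (Lam (App (App (App F (Var 1)) TRUE) (Var 0)))) l hA.
by rewrite /HAS; ev_partly; apply: H => [|| x y]; try prog; ev.
Qed.
End Lists.

#[local] Hint Resolve CAT_ev : ev.

Ltac ev_higher_order ::=
  first [ eapply MAP_ev; [ | | prog | intro; ev]; prog
        | eapply FILTER_ev; [ prog | prog | intro; ev]
        | eapply HAS_ev; [ prog | prog | intro; ev] ].

Definition SINGLE : term := Eval cbv -[CONS NIL] in
  close (fn x => CONS @ x @ NIL).
Definition ALLPAIRS : term := Eval cbv -[FOLDR CAT MAP NIL] in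
  close (fn f s t => FOLDR @
           (fn x a => CAT @ (MAP @ (fn y => f @ x @ y) @ t) @ a) @ NIL @ s).
(** Takes n tails and then the head; [NIL] is a default for an index out of range. *)
Definition NTH : term := Eval cbv -[ITER NIL] in
  close (fn l n => ITER @ (fn l => l @ NIL @ (fn _ t => t)) @ l @ n @ NIL @
                   (fn x _ => x)).
Definition IOTA : term := Eval cbv -[ITER CONS ZERO MAP SUCC NIL] in
  close (fn n => ITER @ (fn l => CONS @ ZERO @ (MAP @ SUCC @ l)) @ NIL @ n).
Definition OPTIONS : term := Eval cbv -[CONS NONE MAP SOME IOTA] in
  close (fn n => CONS @ NONE @ (MAP @ SOME @ (IOTA @ n))).
Lemma SINGLE_program : program SINGLE. Proof. prog. Qed.
Lemma ALLPAIRS_program : program ALLPAIRS. Proof. prog. Qed.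
Lemma NTH_program : program NTH. Proof. prog. Qed.
Lemma IOTA_program : program IOTA. Proof. prog. Qed.
Lemma OPTIONS_program : program OPTIONS. Proof. prog. Qed.
#[local] Hint Resolve SINGLE_program ALLPAIRS_program NTH_program IOTA_program
  OPTIONS_program : prog.

Lemma SINGLE_ev T (e : T -> term) x : (forall y, program (e y)) ->
  App SINGLE (e x) >* enc_seq e [:: x].
Proof.
by move=> he; have := CONS_ev x [::] he => /= ?; rewrite /SINGLE; ev.
Qed.

Lemma ALLPAIRS_ev A B C (eA : A -> term) (eB : B -> term) (eC : C -> term)
    f F s t :
  (forall x, program (eA x)) -> (forall x, program (eB x)) ->
  (forall x, program (eC x)) -> program F ->
  (forall x y, App (App F (eA x)) (eB y) >* eC (f x y)) ->
  App (App (App ALLPAIRS F) (enc_seq eA s)) (enc_seq eB t) >*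
    enc_seq eC (allpairs f s t).
Proof.
move=> hA hB hC hF Ff.
have -> : allpairs f s t = foldr (fun x a => map (f x) t ++ a) [::] s.
  by elim: s => //= x s ->.
rewrite /ALLPAIRS; ev_partly.
by apply: (@FOLDR_ev _ _ eA (enc_seq eC) (fun x a => map (f x) t ++ a) [::])
  => [||| x y]; try prog; ev.
Qed.

Lemma NTH_ev T (e : T -> term) x0 l n :
  (forall y, program (e y)) -> n < size l ->
  App (App NTH (enc_seq e l)) (enc_nat n) >* e (nth x0 l n).
Proof.
move=> he lt_n.
have H : App (App (App ITER (Lam (App (App (Var 0) NIL) (Lam (Lam (Var 0))))))
    (enc_seq e l)) (enc_nat n) >* enc_seq e (iter n behead l).
  apply: ITER_ev => [y||[|x y]] /=; try prog; by ev.
have it m : iter m behead l = drop m l.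
  by elim: m => [|m IHm]; rewrite ?drop0 //= IHm -drop1 drop_drop.
rewrite it (drop_nth x0 lt_n) /= in H.
by rewrite /NTH; ev.
Qed.

Lemma IOTA_ev n : App IOTA (enc_nat n) >* enc_seq enc_nat (iota 0 n).
Proof.
have -> : iota 0 n = iter n (fun l => 0 :: map succn l) [::].
  by elim: n => //= n <-; rewrite (iotaDl 1).
rewrite /IOTA; ev_partly.
have := fun l => CONS_ev 0 (map succn l) enc_nat_program => /= ?.
by apply: (@ITER_ev _ (enc_seq enc_nat) (fun l => 0 :: map succn l) [::])
  => [|| y]; try prog; ev.
Qed.

Lemma enc_seq_map A B (e : B -> term) (f : A -> B) l :
  enc_seq e (map f l) = enc_seq (fun x => e (f x)) l.
Proof. by elim: l => //= x l ->. Qed.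

Lemma eq_enc_seq A (e e' : A -> term) l : e =1 e' -> enc_seq e l = enc_seq e' l.
Proof. by move=> ee'; elim: l => //= x l ->; rewrite ee'. Qed.

(** * Enumerations of finite types *)

Lemma enum_rankE (T : finType) (x : T) : enum_rank x = index x (enum T) :> nat.
Proof.
by rewrite -{2}(nth_enum_rank x x) index_uniq ?enum_uniq // -cardE.
Qed.

(** Since codes are ranks, a program that knows only the cardinal of a finite type can list the
    codes of all its elements, in enumeration order. *)
Lemma map_enum_rank (T : finType) :
  [seq nat_of_ord (enum_rank x) | x <- enum T] = iota 0 #|T|.
Proof.
rewrite (eq_map (@enum_rankE T)) -[RHS]map_id.
(* An inhabitant is wanted as the default of [nth]; the empty type is treated apart. *)
have [x0 _|T0] := pickP T; last by rewrite eq_card0 // (eq_enum T0) enum0.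
apply: (@eq_from_nth _ 0) => [|i];
  rewrite !size_map ?size_iota ?cardE -?enumT // => lt_i.
by rewrite map_id (nth_map x0) // index_uniq ?enum_uniq // nth_iota.
Qed.

Lemma IOTA_enum_ev (T : finType) :
  App IOTA (enc_nat #|T|) >* enc_seq (@enc_fin T) (enum T).
Proof.
rewrite -(enc_seq_map enc_nat (fun x => nat_of_ord (enum_rank x))).
rewrite map_enum_rank.
exact: IOTA_ev.
Qed.
#[local] Hint Resolve SINGLE_ev IOTA_enum_ev : ev.

Lemma enum_option (T : finType) : enum {: option T} = None :: map some (enum T).
Proof. by rewrite !enumT [in LHS]unlock. Qed.

Lemma enum_sum (A B : finType) :
  enum {: A + B} = map inl (enum A) ++ map inr (enum B).
Proof. by rewrite !enumT [in LHS]unlock. Qed.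

Lemma enum_prod (A B : finType) :
  enum {: A * B} = allpairs pair (enum A) (enum B).
Proof. by rewrite !enumT [in LHS]unlock /= /prod_enum !enumT. Qed.

(** Left summands are enumerated first, so [inl x] keeps the code of x while the code of [inr y] is
    offset by the cardinal of the left type. Programs thus inject on the left for free and on the
    right by an addition. *)
Lemma enc_fin_inl (A B : finType) (x : A) : enc_fin (inl x : A + B) = enc_fin x.
Proof.
rewrite /enc_fin !enum_rankE enum_sum index_cat mem_map; last by move=> ? ? [].
by rewrite mem_enum /= index_map // => ? ? [].
Qed.

Lemma enc_fin_inr (A B : finType) (y : B) :
  enc_fin (inr y : A + B) = enc_nat (#|A| + enum_rank y).
Proof.
rewrite /enc_fin !enum_rankE enum_sum index_cat size_map -cardE.
rewrite index_map; last by move=> ? ? [].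
by case: mapP => [[x _ //]|].
Qed.

Lemma OPTIONS_ev (T : finType) :
  App OPTIONS (enc_nat #|T|) >*
    enc_seq (enc_option (@enc_fin T)) (enum {: option T}).
Proof.
have := CONS_ev None (map some (enum T))
  (fun o => enc_option_program o (@enc_fin_program T)) => /= ?.
rewrite enum_option /OPTIONS.
have H : App (App MAP SOME) (enc_seq (@enc_fin T) (enum T)) >*
    enc_seq (enc_option (@enc_fin T)) (map some (enum T)).
  by apply: MAP_ev => [| | |?]; try prog; ev.
by ev.
Qed.

Lemma ADD_inr_ev (A B : finType) (y : B) :
  App (App ADD (enc_nat #|A|)) (enc_fin y) >* enc_fin (inr y : A + B).
Proof. by rewrite enc_fin_inr; apply: ADD_ev. Qed.

Lemma ADD_card_ev (A B : finType) :
  App (App ADD (enc_nat #|A|)) (enc_nat #|B|) >* enc_nat #|{: A + B}|.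
Proof. by rewrite card_sum; apply: ADD_ev. Qed.

Lemma NTH_enum_ev (A B : finType) (f : A -> B) x :
  App (App NTH (enc_seq (@enc_fin B) (map f (enum A)))) (enc_fin x) >*
    enc_fin (f x).
Proof.
have := @NTH_ev _ (@enc_fin B) (f x) (map f (enum A)) (enum_rank x)
  (@enc_fin_program B).
by rewrite size_map -cardE (nth_map x) -?cardE // nth_enum_rank; apply.
Qed.

Lemma EQN_fin_ev (T : finType) (x y : T) :
  App (App EQN (enc_fin x)) (enc_fin y) >* enc_bool (x == y).
Proof. by rewrite -(inj_eq enum_rank_inj); apply: EQN_ev. Qed.

Lemma EQN_inl_ev (A B : finType) (s : A + B) (x : A) :
  App (App EQN (enc_fin s)) (enc_fin x) >* enc_bool (s == inl x).
Proof. by rewrite -(enc_fin_inl B x); apply: EQN_fin_ev. Qed.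
#[local] Hint Resolve OPTIONS_ev ADD_inr_ev ADD_card_ev NTH_enum_ev EQN_fin_ev
  EQN_inl_ev : ev.

(** * Transitions *)

(** A name for the transition encoding that is local to [enc_fsa]. *)
Definition enc_tr (Q X : finType) (t : Q * option X * Q) : term :=
  enc_pair (enc_fin t.1.1)
    (enc_pair (enc_option (@enc_fin X) t.1.2) (enc_fin t.2)).

Lemma enc_tr_program (Q X : finType) (t : Q * option X * Q) :
  program (enc_tr t).
Proof. by rewrite /enc_tr; prog. Qed.
#[local] Hint Resolve enc_tr_program : prog.

Lemma enc_tr_ev (Q X : finType) (q r : Q) (x : option X) F : program F ->
  App (enc_tr (q, x, r)) F >* App (App F (enc_fin q))
    (enc_pair (enc_option (@enc_fin X) x) (enc_fin r)).
Proof. by move=> hF; apply: enc_pair_ev; prog. Qed.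

Lemma enc_some_ev T (e : T -> term) x F G :
  (forall y, program (e y)) -> program F -> program G ->
  App (App (enc_option e (Some x)) F) G >* App F (e x).
Proof. by move=> he hF hG /=; ev. Qed.

Lemma enc_none_ev T (e : T -> term) F G : program F -> program G ->
  App (App (enc_option e None) F) G >* G.
Proof. by move=> hF hG /=; ev. Qed.
#[local] Hint Resolve enc_tr_ev enc_some_ev enc_none_ev : ev.

Definition TRANS : term := Eval cbv -[PAIR] in
  close (fn q x r => PAIR @ q @ (PAIR @ x @ r)).
Lemma TRANS_program : program TRANS. Proof. prog. Qed.
#[local] Hint Resolve TRANS_program : prog.

Lemma TRANS_ev (Q X : finType) (q r : Q) (x : option X) :
  App (App (App TRANS (enc_fin q)) (enc_option (@enc_fin X) x)) (enc_fin r) >*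
    enc_tr (q, x, r).
Proof. by rewrite /TRANS /enc_tr /=; ev. Qed.

Lemma TRANS_inl_ev (P Q X : finType) (p : P) (r : P + Q) (x : option X) :
  App (App (App TRANS (enc_fin p)) (enc_option (@enc_fin X) x)) (enc_fin r) >*
    enc_tr (inl p : P + Q, x, r).
Proof. by rewrite -(enc_fin_inl Q p); apply: TRANS_ev. Qed.
#[local] Hint Resolve TRANS_ev TRANS_inl_ev : ev.

Definition ALLTRANS : term := Eval cbv -[ALLPAIRS PAIR TRANS] in
  close (fn qs xs => ALLPAIRS @
    (fn p r => p @ (fn q x => TRANS @ q @ x @ r)) @
    (ALLPAIRS @ PAIR @ qs @ xs) @ qs).
Lemma ALLTRANS_program : program ALLTRANS. Proof. prog. Qed.

(** The nesting of the two products follows the enumeration order of the product type. The order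
    matters: filtering this list must give exactly the encoding of a set. *)
Lemma ALLTRANS_ev (Q X : finType) :
  App (App ALLTRANS (enc_seq (@enc_fin Q) (enum Q)))
      (enc_seq (enc_option (@enc_fin X)) (enum {: option X})) >*
    enc_seq (@enc_tr Q X) (enum {: Q * option X * Q}).
Proof.
pose e (p : Q * option X) :=
  enc_pair (enc_fin p.1) (enc_option (@enc_fin X) p.2).
have he p : program (e p) by rewrite /e; prog.
have H : App (App (App ALLPAIRS PAIR) (enc_seq (@enc_fin Q) (enum Q)))
    (enc_seq (enc_option (@enc_fin X)) (enum {: option X})) >*
    enc_seq e (enum {: Q * option X}).
  rewrite enum_prod; apply: ALLPAIRS_ev => [||||x y]; try prog.
  by rewrite /e /=; ev.
rewrite /ALLTRANS enum_prod; ev_partly.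
by apply: ALLPAIRS_ev => [||||[q x] r]; try prog; rewrite /e /=; ev.
Qed.

Definition EQO : term := Eval cbv -[EQN TRUE FALSE] in
  close (fn x y => x @ (fn g => y @ (fn h => EQN @ g @ h) @ FALSE) @
                       (y @ (fn _ => FALSE) @ TRUE)).
Lemma EQO_program : program EQO. Proof. prog. Qed.

Lemma EQO_ev (X : finType) (x y : option X) :
  App (App EQO (enc_option (@enc_fin X) x)) (enc_option (@enc_fin X) y) >*
    enc_bool (x == y).
Proof. by rewrite /EQO; case: x y => [x|] [y|]; ev. Qed.
#[local] Hint Resolve ALLTRANS_program EQO_program : prog.
#[local] Hint Resolve ALLTRANS_ev EQO_ev : ev.

Definition EQT : term := Eval cbv -[EQN EQO FALSE] in
  close (fn t u => t @ (fn q xr => xr @ (fn x r =>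
                   u @ (fn q' yr => yr @ (fn y r' =>
    EQN @ q @ q' @ (EQO @ x @ y @ (EQN @ r @ r') @ FALSE) @ FALSE))))).
Lemma EQT_program : program EQT. Proof. prog. Qed.

Lemma EQT_ev (Q X : finType) (t u : Q * option X * Q) :
  App (App EQT (enc_tr t)) (enc_tr u) >* enc_bool (t == u).
Proof.
case: t u => [[q x] r] [[q' y] r'].
have -> : ((q, x, r) == (q', y, r')) = (q == q') && ((x == y) && (r == r')).
  by rewrite andbA.
by rewrite /EQT; ev.
Qed.

Definition MEM : term := Eval cbv -[HAS EQT] in
  close (fn t l => HAS @ (fn u => EQT @ u @ t) @ l).
Lemma MEM_program : program MEM. Proof. prog. Qed.
#[local] Hint Resolve EQT_program MEM_program : prog.
#[local] Hint Resolve EQT_ev : ev.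

Lemma MEM_ev (Q X : finType) (t : Q * option X * Q) l :
  App (App MEM (enc_tr t)) (enc_seq (@enc_tr Q X) l) >* enc_bool (t \in l).
Proof. by rewrite -has_pred1 /MEM; ev. Qed.
#[local] Hint Resolve MEM_ev : ev.

(** * Saturation in L *)

Definition FSA : term := Eval cbv -[PAIR SINGLE] in
  close (fn n T s q =>
    PAIR @ n @ (PAIR @ T @ (PAIR @ (SINGLE @ s) @ (SINGLE @ q)))).
(** Under call by value [d] is queried even for those p that fail the equality test; this is
    harmless because [d] answers on all arguments. *)
Definition HIT : term := Eval cbv -[EQN HAS FSA FALSE] in
  close (fn d ps ais n T t => t @ (fn s xq => xq @ (fn x q => HAS @
    (fn p => EQN @ s @ p @ (x @
      (fn g => HAS @ (fn a => HAS @
         (fn p' => d @ (FSA @ n @ T @ p' @ q) @ p @ g @ a @ p') @ ps) @ ais) @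
      FALSE) @ FALSE) @ ps))).
(* The outer fold over the list us of all transitions only counts iterations. *)
Definition SATURATE : term := Eval cbv -[FOLDR FILTER MEM HIT TRUE NIL] in
  close (fn d ps ais n us t0 => FOLDR @
    (fn _ T => FILTER @
       (fn t => MEM @ t @ t0 @ TRUE @ (HIT @ d @ ps @ ais @ n @ T @ t)) @ us) @
    NIL @ us).
Lemma FSA_program : program FSA. Proof. prog. Qed.
Lemma HIT_program : program HIT. Proof. prog. Qed.
Lemma SATURATE_program : program SATURATE. Proof. prog. Qed.
#[local] Hint Resolve FSA_program HIT_program SATURATE_program : prog.

Lemma enc_set_program (T : finType) (e : T -> term) (A : {set T}) :
  (forall x, program (e x)) -> program (enc_set e A).
Proof. exact: enc_seq_program. Qed.
#[local] Hint Resolve enc_set_program : prog.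

Lemma enc_fsa_program (X : finType) (A : fsa X) : program (enc_fsa A).
Proof.
by do 3![apply: enc_pair_program; try prog]; apply: enc_set_program => t; prog.
Qed.
#[local] Hint Resolve enc_fsa_program : prog.

Section Saturation.
Variables P Q S X : finType.
Local Notation transition := ((P + Q) * option X * (P + Q))%type.
Implicit Type T : {set transition}.

Lemma FSA_ev T (p : P) (q : P + Q) :
  App (App (App (App FSA (enc_nat #|{: P + Q}|)) (enc_set (@enc_tr _ X) T))
    (enc_fin p)) (enc_fin q) >* enc_fsa (Fsa T [set inl p] [set q]).
Proof.
have -> : enc_fsa (Fsa T [set inl p] [set q]) =
    enc_pair (enc_nat #|{: P + Q}|) (enc_pair (enc_set (@enc_tr _ X) T)
      (enc_pair (enc_seq (@enc_fin _) [:: inl p : P + Q])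
                (enc_seq (@enc_fin _) [:: q]))).
  by rewrite /enc_fsa /enc_set !enum_set1.
by rewrite -(enc_fin_inl Q p) /FSA; ev.
Qed.

Variable D : {set transition} * P * X * option S * P * (P + Q) -> bool.

Definition hit T (t : transition) : bool :=
  has (fun p => (t.1.1 == inl p) &&
    if t.1.2 is Some g then
      has (fun a => has (fun p' => D (T, p, g, a, p', t.2)) (enum P))
        (enum {: option S})
    else false) (enum P).

Variable d : term.
Hypothesis hd : program d.
Hypothesis Dd : forall T p g a p' q,
  App (App (App (App (App d (enc_fsa (Fsa T [set inl p'] [set q])))
    (enc_fin p)) (enc_fin g)) (enc_option (@enc_fin S) a)) (enc_fin p')
  >* enc_bool (D (T, p, g, a, p', q)).

Lemma HIT_ev T t :
  App (App (App (App (App (App HIT d) (enc_seq (@enc_fin P) (enum P)))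
    (enc_seq (enc_option (@enc_fin S)) (enum {: option S})))
    (enc_nat #|{: P + Q}|)) (enc_set (@enc_tr _ X) T)) (enc_tr t) >*
  enc_bool (hit T t).
Proof.
have FSA_ev' := FSA_ev.
case: t => [[s [g|]] q]; rewrite /HIT; ev.
Qed.

Definition saturate1 (t0 : seq transition) T : {set transition} :=
  [set t | (t \in t0) || hit T t].

Lemma SATURATE_ev t0 :
  App (App (App (App (App (App SATURATE d) (enc_seq (@enc_fin P) (enum P)))
    (enc_seq (enc_option (@enc_fin S)) (enum {: option S})))
    (enc_nat #|{: P + Q}|)) (enc_seq (@enc_tr _ X) (enum {: transition})))
    (enc_seq (@enc_tr _ X) t0) >*
  enc_set (@enc_tr _ X) (fixset (saturate1 t0)).
Proof.
(* [fixset] iterates from the empty set as often as there are transitions, which is a fold over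
   their list ignoring the elements. *)
have -> : fixset (saturate1 t0) =
    foldr (fun _ => saturate1 t0) set0 (enum {: transition}).
  by rewrite /fixset cardE; elim: (enum _) => //= x l ->.
have HIT_ev' := HIT_ev.
rewrite /SATURATE; ev_partly.
have -> : NIL = enc_set (@enc_tr _ X) (set0 : {set transition}).
  by rewrite /enc_set enum_set0.
apply: FOLDR_ev => [|||x T]; try prog.
(* The enumeration of a set is a filtering of the enumeration of its type. *)
have -> : enc_set (@enc_tr _ X) (saturate1 t0 T) = enc_seq (@enc_tr _ X)
    [seq t <- enum {: transition} | (t \in t0) || hit T t].
  congr enc_seq; rewrite {1}/enum_mem -enumT; apply: eq_filter => t.
  by rewrite /= in_set.
by ev.
Qed.

End Saturation.

(** * Correctness of saturation *)

Section Runs.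
Variable X : finType.
Implicit Type A : fsa X.

Lemma fsa_run_cat A q u r v s :
  @fsa_run X A q u r -> fsa_run r v s -> fsa_run q (u ++ v) s.
Proof.
move=> qr rs; elim: qr rs => [//|? ? ? ? t _ IH|? ? ? ? ? t _ IH] /IH.
  exact: fsa_run_eps.
exact: fsa_run_sym.
Qed.

Lemma fsa_run_split A q u v s :
  @fsa_run X A q (u ++ v) s -> exists2 r, fsa_run q u r & fsa_run r v s.
Proof.
move Dw: (u ++ v) => w qs.
elim: qs u Dw => {q w s} [q|q q' s w t _ IH|q x q' s w t run IH] u Dw.
- by case: u v Dw => [|//] [|//] _; exists q; apply: fsa_run_nil.
- by have [r qr rs] := IH u Dw; exists r => //; apply: fsa_run_eps t qr.
case: u Dw => [/= ->|y u [-> Dw]].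
  by exists q; [apply: fsa_run_nil | apply: fsa_run_sym t run].
by have [r qr rs] := IH u Dw; exists r => //; apply: fsa_run_sym t qr.
Qed.

(** Runs see only transitions; besides monotonicity, this allows initial and final states to be
    exchanged freely. *)
Lemma fsa_run_sub (Q : finType) (T T' : {set Q * option X * Q}) I I' F F'
    q w r :
  T \subset T' ->
  @fsa_run X (Fsa T I F) q w r -> @fsa_run X (Fsa T' I' F') q w r.
Proof.
move=> /subsetP sT.
elim=> {q w r} [q|q q' r w /sT t _ IH|q x q' r w /sT t _ IH].
- exact: fsa_run_nil.
- by apply: fsa_run_eps IH.
- by apply: fsa_run_sym IH.
Qed.

Lemma fsa_lang1 (Q : finType) (T : {set Q * option X * Q}) p q w :
  fsa_lang (Fsa T [set p] [set q]) w <-> @fsa_run X (Fsa T set0 set0) p w q.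
Proof.
split=> [[p' [q' [/set1P -> /set1P ->]]]|pq]; first exact: fsa_run_sub.
by exists p, q; rewrite !set11; split=> //; apply: fsa_run_sub pq.
Qed.

End Runs.

Section Correctness.
Variables (P : gpa) (A : paut P).
Local Notation X := (gpa_stack P).
Local Notation Q := (fsa_state A).
Local Notation state := (gpa_state P + Q)%type.
Local Notation transition := (state * option X * state)%type.
Local Notation steps :=
  (clos_refl_trans (config P) (fun c1 c2 => exists a, gpa_step c1 a c2)).
Implicit Type T : {set transition}.

Lemma paut_langP (c : config P) :
  paut_lang A c <->
  exists2 q, q \in fsa_final A & @fsa_run _ A (paut_inj A c.1) c.2 q.
Proof.
rewrite /paut_lang /fsa_lang; case: (paut_fsa A) (paut_inj A c.1) => R T I F p.
split=> [[p' [q [/set1P -> qF run]]]|[q qF run]].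
  by exists q => //; apply: fsa_run_sub run.
by exists p, q; rewrite set11; split=> //; apply: fsa_run_sub run.
Qed.

Definition copy_trans : seq transition :=
  [seq (inl p, None, inr (paut_inj A p)) | p <- enum (gpa_state P)] ++
  [seq (inr t.1.1, t.1.2, inr t.2) | t <- enum (fsa_trans A)].

Lemma copy_inl p x s :
  (inl p, x, s) \in copy_trans -> x = None /\ s = inr (paut_inj A p).
Proof. by rewrite mem_cat => /orP[] /mapP[] ? _ [] // -> -> ->. Qed.

Lemma copy_eps p : (inl p, None, inr (paut_inj A p)) \in copy_trans.
Proof.
by rewrite mem_cat; apply/orP; left; apply/mapP; exists p; rewrite ?mem_enum.
Qed.

Lemma copy_inr q x s : (inr q, x, s) \in copy_trans <->
  exists2 q', s = inr q' & (q, x, q') \in fsa_trans A.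
Proof.
rewrite mem_cat; split=> [/orP[] /mapP[]|[q' -> t]].
- by move=> ? _ [].
- by case=> [[q1 x1] q2] /=; rewrite mem_enum => t [-> -> ->]; exists q2.
by apply/orP; right; apply/mapP; exists (q, x, q'); rewrite ?mem_enum.
Qed.

Variable D : {set transition} * gpa_state P * X * option (gpa_input P) *
  gpa_state P * state -> bool.
Hypothesis DP : forall T p g a p' q, D (T, p, g, a, p', q) <->
  exists2 u, fsa_lang (Fsa T [set inl p'] [set q]) u & gpa_delta p g a p' u.

Local Notation run T := (@fsa_run X (@Fsa X state T set0 set0)).

Lemma hitP T s x r : hit D T (s, x, r) <->
  exists p g a p' u, [/\ s = inl p, x = Some g, gpa_delta p g a p' u &
                      run T (inl p') u r].
Proof.
split.
  case/hasP=> p _ /andP[/eqP /= ->].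
  case: x => // g /hasP[a _ /hasP[p' _ /DP]].
  by case=> u /fsa_lang1 ? ?; exists p, g, a, p', u.
case=> p [g [a [p' [u [-> -> pu ur]]]]].
apply/hasP; exists p; rewrite ?mem_enum // eqxx /=.
apply/hasP; exists a; rewrite ?mem_enum //.
apply/hasP; exists p'; rewrite ?mem_enum //.
by apply/DP; exists u => //; apply/fsa_lang1.
Qed.

Local Notation F := (saturate1 D copy_trans).
Local Notation sat := (fixset F).

Lemma saturate1_mono : {homo F : T T' / T \subset T'}.
Proof.
move=> T T' sT; apply/subsetP=> -[[s x] r]; rewrite !in_set.
case/orP=> [->//|/hitP[p [g [a [p' [u [-> -> pu ur]]]]]]].
apply/orP; right; apply/hitP; exists p, g, a, p', u; split=> //.
exact: fsa_run_sub ur.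
Qed.

Lemma in_sat t : (t \in sat) = (t \in copy_trans) || hit D sat t.
Proof. by rewrite -{1}(fixsetK saturate1_mono) in_set. Qed.

Lemma steps_cat p u p' u' w :
  steps (p, u) (p', u') -> steps (p, u ++ w) (p', u' ++ w).
Proof.
suff: forall c c', steps c c' -> steps (c.1, c.2 ++ w) (c'.1, c'.2 ++ w).
  by move=> h /h.
move=> c c'; elim=> [c1 c2 [a [q g b q' v v' qv]]|c1|c1 c2 c3 _ h _].
- by apply: rt_step; exists b; rewrite /= -catA; constructor.
- exact: rt_refl.
- exact: rt_trans.
Qed.

Lemma steps_delta p g a p' u w : gpa_delta p g a p' u ->
  steps (p, g :: w) (p', u ++ w).
Proof. by move=> pu; apply: rt_step; exists a; constructor. Qed.

(** Transitions added by saturation start in [inl] states, and copied ones from [inr] states stay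
    among them. *)
Lemma run_saturate1_inr T q w s :
  run (F T) (inr q) w s -> exists2 q', s = inr q' & @fsa_run _ A q w q'.
Proof.
move Dr: (inr q) => r rs.
elim: rs q Dr => {r w s} [r|r r' s w t _ IH|r x r' s w t _ IH] q Dr.
- by exists q => //; apply: fsa_run_nil.
- move: t; rewrite -Dr in_set.
  case/orP=> [/copy_inr[q1 Dr' t]|/hitP[? [? [? [? [? []]]]]] //].
  have [q2 -> ?] := IH q1 (esym Dr'); exists q2 => //.
  exact: fsa_run_eps t _.
move: t; rewrite -Dr in_set.
case/orP=> [/copy_inr[q1 Dr' t]|/hitP[? [? [? [? [? []]]]]] //].
by have [q2 -> ?] := IH q1 (esym Dr'); exists q2 => //; apply: fsa_run_sym t _.
Qed.

(** How simulated steps may end: at [inl p'] everything read has been popped, and at [inr q] the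
    remaining stack is read by [A] itself. *)
Definition base_run p w (s : state) : Prop :=
  match s with
  | inl p' => p = p' /\ w = [::]
  | inr q => @fsa_run _ A (paut_inj A p) w q
  end.

(** An added transition is justified by a run of the previous iterate (outer induction), the rest of
    the run by the inner induction. *)
Lemma run_saturate_sound n p w s : run (iter n F set0) (inl p) w s ->
  exists p' w', steps (p, w) (p', w') /\ base_run p' w' s.
Proof.
elim: n p w s => [|n IHn] p w s.
  move Dr: (inl p) => r rs.
  case: {r w s} _ _ _ / rs Dr => [r|r r' s w|r x r' s w].
  - by move=> <-; exists p, [::]; split=> //; apply: rt_refl.
  - by rewrite in_set0.
  - by rewrite in_set0.
rewrite iterS; move: (iter n F set0) IHn => T IHT.
move Dr: (inl p) => r rs.
elim: rs p Dr => {r w s} [r|r r' s w t run IH|r x r' s w t run IH] p Dr.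
- by exists p, [::]; rewrite -Dr; split=> //; apply: rt_refl.
- move: t; rewrite -Dr in_set.
  case/orP=> [/copy_inl[_ Dr']|/hitP[? [? [? [? [? []]]]]] //].
  move: run; rewrite Dr' => /run_saturate1_inr[q -> pq].
  by exists p, w; split=> //; apply: rt_refl.
move: t; rewrite -Dr in_set => /orP[/copy_inl[] // |].
case/hitP=> _ [_ [a [p1 [u [[<-] [<-] pu ur]]]]].
have {ur} [p2 [w2 [up2 p2r]]] := IHT _ _ _ ur.
have pp2: steps (p, x :: w) (p2, w2 ++ w).
  by apply: rt_trans (steps_delta w pu) _; apply: steps_cat.
(* Either the word u has been popped and the run goes on from an [inl] state, or it has entered the
   copy of [A] for good and the two runs of [A] are concatenated. *)
case: r' p2r run IH => [p3 [<- w2_0]|q p2q] run IH.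
  have [p' [w' [h1 h2]]] := IH p2 erefl; exists p', w'; split=> //.
  by apply: rt_trans pp2 _; rewrite w2_0.
have [q' -> qq'] := run_saturate1_inr run; exists p2, (w2 ++ w); split=> //=.
exact: fsa_run_cat p2q qq'.
Qed.

Lemma run_sat_lift q w q' : @fsa_run _ A q w q' -> run sat (inr q) w (inr q').
Proof.
elim=> {q w q'} [q|q q' r w t _|q x q' r w t _]; first exact: fsa_run_nil.
  apply: fsa_run_eps; rewrite in_sat; apply/orP; left.
  by apply/copy_inr; exists q'.
apply: fsa_run_sym; rewrite in_sat; apply/orP; left.
by apply/copy_inr; exists q'.
Qed.

(** The state reached after the pushed word u is the target of a transition on the popped symbol,
    present because [sat] is closed under [hit]. *)
Lemma run_saturate_complete c c' q : steps c c' ->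
  run sat (inl c'.1) c'.2 q -> run sat (inl c.1) c.2 q.
Proof.
elim=> {c c'} [c c' [a [p g b p' u w pu]] /= /fsa_run_split[r ur rq]|//|].
  apply: fsa_run_sym rq; rewrite in_sat; apply/orP; right; apply/hitP.
  by exists p, g, b, p', u.
by move=> c1 c2 c3 _ h1 _ h2 /h2.
Qed.

Lemma inl_inj : injective (@inl (gpa_state P) Q). Proof. by move=> ? ? []. Qed.

Definition sat_paut : paut P :=
  @Paut P (Fsa sat [set inl p | p : gpa_state P] [set inr q | q in fsa_final A])
    inl inl_inj erefl.

Lemma sat_pautP c : paut_lang sat_paut c <-> pre_star (paut_lang A) c.
Proof.
split=> [[_ [_ [/set1P -> /imsetP[q qF ->] cq]]]
        |[c' /paut_langP[q qF c'q] cc']].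
  have {}cq : run (iter #|{: transition}| F set0) (inl c.1) c.2 (inr q).
    exact: fsa_run_sub cq.
  have [p [w [cpw pq]]] := run_saturate_sound cq.
  exists (p, w); first by apply/paut_langP; exists q.
  by rewrite [c]surjective_pairing.
exists (inl c.1), (inr q); split; [exact: set11 | exact: imset_f |].
suff: run sat (inl c.1) c.2 (inr q) by apply: fsa_run_sub.
apply: run_saturate_complete cc' _; apply: fsa_run_eps (run_sat_lift c'q).
by rewrite in_sat copy_eps.
Qed.

End Correctness.

(** * The whole construction *)

Lemma enc_gpa_program (P : gpa) : program (enc_gpa P).
Proof. by rewrite /enc_gpa /enc_set; prog. Qed.

Lemma enc_paut_program (P : gpa) (A : paut P) : program (enc_paut A).
Proof. by rewrite /enc_paut; prog. Qed.
#[local] Hint Resolve SATURATE_program enc_gpa_program enc_paut_program : prog.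

Definition SHIFT : term := Eval cbv -[TRANS ADD] in
  close (fn m t => t @ (fn q xr => xr @ (fn x r =>
    TRANS @ (ADD @ m @ q) @ x @ (ADD @ m @ r)))).
Definition COPY : term := Eval cbv -[CAT MAP TRANS NONE ADD NTH SHIFT] in
  close (fn m ps tr inj => CAT @
    (MAP @ (fn p => TRANS @ p @ NONE @ (ADD @ m @ (NTH @ inj @ p))) @ ps) @
    (MAP @ (fn t => SHIFT @ m @ t) @ tr)).
Lemma SHIFT_program : program SHIFT. Proof. prog. Qed.
Lemma COPY_program : program COPY. Proof. prog. Qed.
#[local] Hint Resolve SHIFT_program COPY_program : prog.

Lemma SHIFT_ev (P Q X : finType) (t : Q * option X * Q) :
  App (App SHIFT (enc_nat #|P|)) (enc_tr t) >*
    enc_tr (inr t.1.1 : P + Q, t.1.2, inr t.2 : P + Q).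
Proof. by case: t => [[q x] r]; rewrite /SHIFT /=; ev. Qed.
#[local] Hint Resolve SHIFT_ev : ev.

Lemma COPY_ev (P : gpa) (A : paut P) :
  App (App (App (App COPY (enc_nat #|gpa_state P|))
    (enc_seq (@enc_fin _) (enum (gpa_state P))))
    (enc_set (@enc_tr _ _) (fsa_trans A)))
    (enc_seq (@enc_fin _) [seq paut_inj A p | p <- enum (gpa_state P)]) >*
  enc_seq (@enc_tr _ _) (copy_trans A).
Proof.
(* The general lemma restated for the constant [NONE], which the syntactic automation does not
   identify with an encoded [None]. *)
have NONE_ev p r : App (App (App TRANS (enc_fin p)) NONE) (enc_fin r) >*
    enc_tr (inl p : gpa_state P + fsa_state A, None : option (gpa_stack P), r).
  exact: (TRANS_inl_ev p r None).
by rewrite /COPY /enc_set /copy_trans; ev.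
Qed.
#[local] Hint Resolve COPY_ev : ev.

(** The list [ps] serves twice: the initial states and the injection of the new automaton have the
    same encoding. *)
Definition RESULT : term := Eval cbv -[PAIR] in
  close (fn n ps fin tr =>
    PAIR @ (PAIR @ n @ (PAIR @ tr @ (PAIR @ ps @ fin))) @ ps).
Lemma RESULT_program : program RESULT. Proof. prog. Qed.

Lemma RESULT_ev n ps fin tr :
  program n -> program ps -> program fin -> program tr ->
  App (App (App (App RESULT n) ps) fin) tr >*
    enc_pair (enc_pair n (enc_pair tr (enc_pair ps fin))) ps.
Proof. by move=> *; rewrite /RESULT; ev. Qed.
#[local] Hint Resolve ALLTRANS_program RESULT_program : prog.
#[local] Hint Resolve RESULT_ev : ev.

Definition BUILD : term :=
  Eval cbv -[RESULT SATURATE MAP ADD IOTA OPTIONS ALLTRANS COPY] in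
  close (fn d nP nS nX nQ tr fin inj => (fn ps n =>
    RESULT @ n @ ps @ (MAP @ (fn q => ADD @ nP @ q) @ fin) @
      (SATURATE @ d @ ps @ (OPTIONS @ nS) @ n @
         (ALLTRANS @ (IOTA @ n) @ (OPTIONS @ nX)) @
         (COPY @ nP @ ps @ tr @ inj)))
    @ (IOTA @ nP) @ (ADD @ nP @ nQ)).
Definition MAIN : term := Eval cbv -[BUILD] in
  close (fn d P A => P @ (fn nP r => r @ (fn nS r => r @ (fn nX _ =>
    A @ (fn fa inj => fa @ (fn nQ r => r @ (fn tr r => r @ (fn _ fin =>
      BUILD @ d @ nP @ nS @ nX @ nQ @ tr @ fin @ inj)))))))).
Lemma BUILD_program : program BUILD. Proof. prog. Qed.
#[local] Hint Resolve BUILD_program : prog.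
Lemma MAIN_program : program MAIN. Proof. prog. Qed.

Lemma enum_inl (A B : finType) :
  enum [set (inl a : A + B) | a : A] = map inl (enum A).
Proof.
rewrite {1}/enum_mem -enumT enum_sum filter_cat !filter_map.
rewrite (eq_filter (a2 := predT)) ?filter_predT => [|a /=]; last first.
  by rewrite imset_f.
rewrite (eq_filter (a2 := pred0)) ?filter_pred0 ?cats0 // => b /=.
by apply/imsetP=> -[].
Qed.

Lemma enum_inr (A B : finType) (F : {set B}) :
  enum [set (inr b : A + B) | b in F] = map inr (enum F).
Proof.
rewrite {1}/enum_mem -enumT enum_sum filter_cat !filter_map.
rewrite (eq_filter (a2 := pred0)) ?filter_pred0 => [|a /=]; last first.
  by apply/imsetP=> -[].
rewrite (eq_filter (a2 := mem F)) => [|b /=]; last first.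
  by rewrite mem_imset // => ? ? [].
by rewrite /= !map_id.
Qed.

Lemma enc_sat_paut (P : gpa) (A : paut P) D :
  enc_paut (@sat_paut P A D) =
  enc_pair (enc_pair (enc_nat #|{: gpa_state P + fsa_state A}|)
    (enc_pair (enc_set (@enc_tr _ _) (fixset (saturate1 D (copy_trans A))))
      (enc_pair (enc_seq (@enc_fin _) (enum (gpa_state P)))
        (enc_seq (@enc_fin _)
           [seq inr q : gpa_state P + fsa_state A | q <- enum (fsa_final A)]))))
    (enc_seq (@enc_fin _) (enum (gpa_state P))).
Proof.
rewrite /enc_paut /enc_fsa /enc_set /sat_paut enum_inl enum_inr !enc_seq_map.
by rewrite !(eq_enc_seq _ (@enc_fin_inl _ _)).
Qed.

Lemma MAIN_ev (P : gpa) (A : paut P) D d : program d ->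
  (forall (T : {set (gpa_state P + fsa_state A) * option (gpa_stack P) *
                    (gpa_state P + fsa_state A)}) p g a p' q,
    App (App (App (App (App d (enc_fsa (Fsa T [set inl p'] [set q])))
      (enc_fin p)) (enc_fin g)) (enc_option (@enc_fin _) a)) (enc_fin p')
    >* enc_bool (D (T, p, g, a, p', q))) ->
  App (App (App MAIN d) (enc_gpa P)) (enc_paut A) >* enc_paut (@sat_paut P A D).
Proof.
move=> hd Dd.
have SAT_ev := SATURATE_ev hd Dd (copy_trans A).
have BUILD_ev :
  App (App (App (App (App (App (App (App BUILD d) (enc_nat #|gpa_state P|))
    (enc_nat #|gpa_input P|)) (enc_nat #|gpa_stack P|))
    (enc_nat #|fsa_state A|)) (enc_set (@enc_tr _ _) (fsa_trans A)))
    (enc_set (@enc_fin _) (fsa_final A)))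
    (enc_seq (@enc_fin _) [seq paut_inj A p | p <- enum (gpa_state P)]) >*
  enc_paut (@sat_paut P A D).
  by rewrite enc_sat_paut /BUILD; ev.
have -> : enc_paut A =
    enc_pair (enc_pair (enc_nat #|fsa_state A|)
      (enc_pair (enc_set (@enc_tr _ _) (fsa_trans A))
        (enc_pair (enc_set (@enc_fin _) (fsa_init A))
                  (enc_set (@enc_fin _) (fsa_final A)))))
      (enc_seq (@enc_fin _) [seq paut_inj A p | p <- enum (gpa_state P)]) by [].
by rewrite /MAIN /enc_gpa; ev.
Qed.

Theorem theorem2p3 :
  exists M : term, program M /\
  forall (P : gpa) (d : term), effective_by P d ->
  forall A : paut P,
  exists A' : paut P,
    evaluates (apps M [:: d; enc_gpa P; enc_paut A]) (enc_paut A') /\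
    forall c : config P, paut_lang A' c <-> pre_star (paut_lang A) c.
Proof.
exists MAIN; split; first exact: MAIN_program.
move=> P d [hd Ed] A.
pose state := (gpa_state P + fsa_state A)%type.
(* The answers of [d] are collected into a function [D] by choice over a finite type. [D] serves the
   specification only; [MAIN] queries [d] itself. *)
have /fin_all_exists[D DP] : forall x :
    {set state * option (gpa_stack P) * state} * gpa_state P *
      gpa_stack P * option (gpa_input P) * gpa_state P * state,
    exists b : bool, let: (T, p, g, a, p', q) := x in
      App (App (App (App (App d (enc_fsa (Fsa T [set inl p'] [set q])))
        (enc_fin p)) (enc_fin g)) (enc_option (@enc_fin _) a)) (enc_fin p')
      >* enc_bool b /\
      (b <-> exists2 u, fsa_lang (Fsa T [set inl p'] [set q]) u &
             gpa_delta p g a p' u).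
  move=> [[[[[T p] g] a] p'] q].
  by have [b [db _] bP] := Ed (Fsa T [set inl p'] [set q]) p g a p'; exists b.
exists (@sat_paut P A D); split.
  split; last exact: (enc_paut_program _).2.
  by apply: MAIN_ev => // T p g a p' q; have [] := DP (T, p, g, a, p', q).
by apply: sat_pautP => T p g a p' q; have [] := DP (T, p, g, a, p', q).
Qed.
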